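(* Let $\Omega = \mathbb{R}^2/(2\pi\mathbb{Z})^2$ be the flat two-dimensional torus, let $\tau>0$ and $\lambda>0$, let $f$ be a given image on $\Omega$, let $\mathcal{S}$ be a set (the admissible parameter set), and let $F_1, F_2$ be maps assigning to each $\Theta\in\mathcal{S}$ real-valued functions $x\mapsto F_1(f,\Theta)(x)$, $x\mapsto F_2(f,\Theta)(x)$ in $L^1(\Omega)$. For measurable $u:\Omega\to\{0,1\}$ and $\Theta\in\mathcal{S}$ define $$\mathcal{E}^\tau(u,\Theta) = \int_\Omega \big[u\,F_1(f,\Theta) + (1-u)\,F_2(f,\Theta)\big]\,dx + \lambda\sqrt{\tfrac{\pi}{\tau}}\int_\Omega u\, \big(G_\tau*(1-u)\big)\,dx .$$ Let $(u^k,\Theta^k)_{k\ge 1}$ be any sequence generated by the following iteration (the two-phase ICTM), starting from a measurable $u^1:\Omega\to\{0,1\}$: (1) $\Theta^k \in \arg\min_{\Theta\in\mathcal{S}} \int_\Omega \big[u^k F_1(f,\Theta) + (1-u^k)F_2(f,\Theta)\big]\,dx$ (a minimizer is assumed to exist at every step); (2) $\phi^k = F_1(f,\Theta^k) - F_2(f,\Theta^k) + \lambda\sqrt{\tfrac{\pi}{\tau}}\, G_\tau*(1-2u^k)$; (3) $u^{k+1}(x) = 1$ if $\phi^k(x)\le 0$ and $u^{k+1}(x)=0$ otherwise. Then for every $k\ge1$ and every $\tau>0$, $$\mathcal{E}^\tau(u^{k+1},\Theta^{k+1}) \le \mathcal{E}^\tau(u^k,\Theta^k).$$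
   Context: $G_\tau$ denotes the heat kernel on the torus $\Omega$, i.e. the $2\pi\mathbb{Z}^2$-periodization $G_\tau(x)=\sum_{m\in\mathbb{Z}^2}\frac{1}{4\pi\tau}\exp\!\big(-\frac{|x+2\pi m|^2}{4\tau}\big)$ of the Gaussian $\frac{1}{4\pi\tau}e^{-|x|^2/(4\tau)}$, and $*$ is convolution on $\Omega$: $(G_\tau*v)(x)=\int_\Omega G_\tau(x-y)v(y)\,dy$. The term $\sqrt{\pi/\tau}\int_\Omega u\,G_\tau*(1-u)\,dx$ is the paper's heat-kernel approximation of the perimeter of the set $\{u=1\}$; $F_1,F_2$ are the fidelity integrands of a general two-phase segmentation energy, and $\Theta$ collects all parameters/functions appearing in them. *)

(* Defs.v *)
From HB Require Import structures.
From mathcomp Require Import all_boot all_order all_algebra.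
From mathcomp Require Import all_classical all_reals all_analysis.
Set Implicit Arguments. Unset Strict Implicit. Unset Printing Implicit Defensive.
Import Order.TTheory GRing.Theory Num.Theory.
Import numFieldNormedType.Exports.
Local Open Scope classical_set_scope.
Local Open Scope ring_scope.

(* The torus Omega = R^2/(2pi Z)^2 is represented by its fundamental domain
   [0,2pi) x [0,2pi) in R*R with the (product) Lebesgue measure.
   Functions on Omega are functions R*R -> R of which only the values on
   the fundamental domain matter (all convolution kernels below are
   2pi-periodic, so x - y may be taken in R^2). *)

Definition leb2 (R : realType) :=
  ((@lebesgue_measure R) \x (@lebesgue_measure R))%E.
Arguments leb2 R : clear implicits.

Definition Omega (R : realType) : set (R * R) :=
  `[0%R, 2 * pi[%classic `*` `[0%R, 2 * pi[%classic.
Arguments Omega R : clear implicits.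

Definition intO (R : realType) (g : R * R -> R) : R :=
  Rintegral (leb2 R) (Omega R) g.

Definition heat_kernel (R : realType) (tau : R) (x : R * R) : R :=
  fine (\esum_(m in [set: int * int])
    ((1 / (4 * pi * tau)) *
      expR (- (((x.1 + 2 * pi * m.1%:~R) ^+ 2 + (x.2 + 2 * pi * m.2%:~R) ^+ 2)
               / (4 * tau))))%:E)%E.

Definition convO (R : realType) (G v : R * R -> R) (x : R * R) : R :=
  intO (fun y => G (x - y)%R * v y).

Definition fidelity (R : realType) (F1 F2 : R * R -> R) (u : R * R -> R) : R :=
  intO (fun x => u x * F1 x + (1 - u x) * F2 x).

Definition energy (R : realType) (tau lambda : R) (F1 F2 : R * R -> R)
  (u : R * R -> R) : R :=
  fidelity F1 F2 u +
  lambda * Num.sqrt (pi / tau) *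
    intO (fun x => u x * convO (heat_kernel tau) (fun y => 1 - u y) x).

(* Main.v *)
Require Import Defs.
From HB Require Import structures.
From mathcomp Require Import all_boot all_order all_algebra.
From mathcomp Require Import all_classical all_reals all_analysis.
From mathcomp Require Import measurable_realfun ring lra zify.
Set Implicit Arguments. Unset Strict Implicit. Unset Printing Implicit Defensive.
Import Order.TTheory GRing.Theory Num.Theory.
Import numFieldNormedType.Exports.
Local Open Scope classical_set_scope.
Local Open Scope ring_scope.

(** Minimizing over Theta lowers only the fidelity term, so everything rests on
    the thresholding step.  With d = u^{k+1} - u^k and B(v,w) the double integral
    of G(x-y) v(x) w(y), the change of energy at fixed Theta^k is
    int d phi^k - c B(d,d).  The first term is nonpositive pointwise; the second
    one because the periodic heat kernel is positive semidefinite.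

    Positive semidefiniteness is obtained without Fourier series: G(x-y) is the
    bounded limit of the Fejer means
    N^-2 sum_{n,n'} g((x + 2 pi n) - (y + 2 pi n')), n and n' ranging over an
    N x N box of lattice points, and expanding exp(<X,Y>/(2 tau)) in
    g(X-Y) = C exp(-|X|^2/(4 tau)) exp(-|Y|^2/(4 tau)) exp(<X,Y>/(2 tau)) exhibits
    each mean as a bounded limit of sums of kernels c h(x) h(y) with c >= 0. *)

(** * Integrals of bounded functions *)

Lemma bounded_fun_integrable (d : measure_display) (T : measurableType d)
    (R : realType) (mu : {measure set T -> \bar R}) (D : set T) (f : T -> R)
    (B : R) :
  measurable D -> (mu D < +oo)%E -> measurable_fun D f ->
  (forall x, D x -> `|f x| <= B) -> mu.-integrable D (EFin \o f).
Proof.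
move=> mD Dfin mf fB; apply: measurable_bounded_integrable => //.
exists B; split; first exact: num_real.
by move=> M BM x Dx; apply: (le_trans (fB x Dx)); exact: ltW.
Qed.

Section bounded_fubini.
Context {d : measure_display} {T : measurableType d} {R : realType}.
Variables (mu : {sigma_finite_measure set T -> \bar R}) (D : set T).
Hypotheses (mD : measurable D) (Dfin : (mu D < +oo)%E).
Variables (k : T * T -> R) (B : R).
Hypotheses (mk : measurable_fun (D `*` D) k).
Hypotheses (kB : forall p, (D `*` D) p -> `|k p| <= B).

Lemma measurable_square : measurable (D `*` D).
Proof. exact: measurableX. Qed.

Lemma square_fin : ((mu \x mu)%E (D `*` D) < +oo)%E.
Proof. by rewrite product_measure1E// lte_mul_pinfty// ge0_fin_numE. Qed.

Lemma bounded_integrable_prod :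
  (mu \x mu)%E.-integrable (D `*` D) (EFin \o k).
Proof.
exact: (bounded_fun_integrable measurable_square square_fin mk kB).
Qed.

(** Fubini is applied on the whole product space, so [k] is extended by zero; [FE] and [GE] identify
    the section integrals of [k0] with those of [k] over [D]. *)
Let k0 : T * T -> \bar R := (EFin \o k) \_ (D `*` D).

Let ik0 : (mu \x mu)%E.-integrable setT k0.
Proof.
by apply/(integrable_mkcond _ measurable_square); exact: bounded_integrable_prod.
Qed.

Let section_integrable x : D x -> mu.-integrable D (fun y => (k (x, y))%:E).
Proof.
move=> Dx; apply: (@bounded_fun_integrable _ _ _ _ _ (fun y => k (x, y)) B) => //.
- have mp : measurable_fun D (fun y : T => (x, y)).
    by apply: measurable_funTS; exact: pair1_measurable.
  apply: (measurable_comp measurable_square _ mk mp).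
  by move=> _ [y Dy <-].
- by move=> y Dy; apply: kB.
Qed.

Let section_integrable2 y : D y -> mu.-integrable D (fun x => (k (x, y))%:E).
Proof.
move=> Dy; apply: (@bounded_fun_integrable _ _ _ _ _ (fun x => k (x, y)) B) => //.
- have mp : measurable_fun D (fun x : T => (x, y)).
    by apply: measurable_funTS; exact: pair2_measurable.
  apply: (measurable_comp measurable_square _ mk mp).
  by move=> _ [x Dx <-].
- by move=> x Dx; apply: kB.
Qed.

Let FE (x : T) : (\int[mu]_y k0 (x, y) =
  ((EFin \o (fun x => Rintegral mu D (fun y => k (x, y)))) \_ D) x)%E.
Proof.
rewrite patchE; case: ifPn => [/set_mem|/negP] Dx /=.
  rewrite /Rintegral fineK; last exact: integrable_fin_num (section_integrable Dx).
  rewrite [RHS]integral_mkcond; apply: eq_integral => y _.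
  rewrite /k0 !patchE; congr (if _ then _ else _).
  by apply/idP/idP => /set_mem; [case=> _ /mem_set|move=> Dy; exact/mem_set].
rewrite integral0_eq// => y _; rewrite /k0 patchE ifF//.
by apply/negP => /set_mem[/mem_set].
Qed.

Let GE (y : T) : (\int[mu]_x k0 (x, y) =
  ((EFin \o (fun y => Rintegral mu D (fun x => k (x, y)))) \_ D) y)%E.
Proof.
rewrite patchE; case: ifPn => [/set_mem|/negP] Dy /=.
  rewrite /Rintegral fineK; last exact: integrable_fin_num (section_integrable2 Dy).
  rewrite [RHS]integral_mkcond; apply: eq_integral => x _.
  rewrite /k0 !patchE; congr (if _ then _ else _).
  by apply/idP/idP => /set_mem; [case=> /mem_set|move=> Dx; exact/mem_set].
rewrite integral0_eq// => x _; rewrite /k0 patchE ifF//.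
by apply/negP => /set_mem[_ /mem_set].
Qed.

Lemma measurable_bounded_section :
  measurable_fun D (fun x => Rintegral mu D (fun y => k (x, y))).
Proof.
apply/measurable_EFinP.
apply/(measurable_restrictT _ mD).
rewrite -(funext FE); exact: measurable_fubini_F ik0.
Qed.

Lemma bounded_fubini12 :
  Rintegral mu D (fun x => Rintegral mu D (fun y => k (x, y))) =
  Rintegral (mu \x mu)%E (D `*` D) k.
Proof.
rewrite /Rintegral [in RHS]integral_mkcond -integral12_prod_meas1//.
congr fine; rewrite integral_mkcond; apply: eq_integral => x _.
by rewrite [fubini_F _ _ _]FE.
Qed.

Lemma bounded_fubini21 :
  Rintegral mu D (fun y => Rintegral mu D (fun x => k (x, y))) =
  Rintegral (mu \x mu)%E (D `*` D) k.
Proof.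
rewrite /Rintegral [in RHS]integral_mkcond -integral21_prod_meas1//.
congr fine; rewrite integral_mkcond; apply: eq_integral => y _.
by rewrite [fubini_G _ _ _]GE.
Qed.

End bounded_fubini.

(** Dominated convergence with the constant [B] as majorant, integrable because [D] has finite
    measure. *)
Lemma Rintegral_lim_ge0 (d : measure_display) (T : measurableType d)
    (R : realType) (mu : {measure set T -> \bar R}) (D : set T)
    (f_ : nat -> T -> R) (f : T -> R) (B : R) :
  measurable D -> (mu D < +oo)%E -> (forall n, measurable_fun D (f_ n)) ->
  (forall n x, D x -> `|f_ n x| <= B) ->
  (forall x, D x -> f_ ^~ x @ \oo --> f x) ->
  (forall n, 0 <= Rintegral mu D (f_ n)) ->
  0 <= Rintegral mu D f.
Proof.
move=> mD Dfin mf_ f_B f_f f_ge0.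
have f_f' x : D x -> (EFin \o f_ ^~ x) @ \oo --> (f x)%:E.
  by move=> Dx; apply/fine_cvgP; split; [exact: nearW|exact: f_f].
have iB : mu.-integrable D (EFin \o cst B).
  by apply: (@bounded_fun_integrable _ _ _ _ _ _ `|B|).
have [] := @dominated_convergence _ _ _ mu D mD (fun n => EFin \o f_ n)
  (EFin \o f) (EFin \o cst B).
- by move=> n; exact/measurable_EFinP.
- apply: (emeasurable_fun_cvg (fun n => EFin \o f_ n)) => // n.
  exact/measurable_EFinP.
- exact: aeW.
- exact: iB.
- by apply: aeW => x n Dx; rewrite /= lee_fin f_B.
move=> _ _ cvgI; rewrite /Rintegral fine_ge0//.
rewrite -(cvg_lim _ cvgI)//; apply: lime_ge.
  by apply/cvg_ex; eexists; exact: cvgI.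
apply: nearW => n /=; have := f_ge0 n; rewrite /Rintegral -lee_fin fineK//.
apply: integrable_fin_num => //.
exact: bounded_fun_integrable (f_B n).
Qed.

(** * Algebra of bounded measurable functions *)

Definition bounded_mfun (d : measure_display) (T : measurableType d)
    (R : realType) (D : set T) (f : T -> R) :=
  measurable_fun D f /\ exists B : R, forall x, D x -> `|f x| <= B.

Lemma bounded_mfunM (d : measure_display) (T : measurableType d)
    (R : realType) (D : set T) (f g : T -> R) :
  bounded_mfun D f -> bounded_mfun D g -> bounded_mfun D (fun x => f x * g x).
Proof.
move=> [mf [B fB]] [mg [C gC]]; split; first exact: measurable_funM.
exists (B * C) => x Dx; rewrite normrM.
by apply: ler_pM; rewrite ?fB ?gC.
Qed.

Lemma bounded_mfunB (d : measure_display) (T : measurableType d)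
    (R : realType) (D : set T) (f g : T -> R) :
  bounded_mfun D f -> bounded_mfun D g -> bounded_mfun D (fun x => f x - g x).
Proof.
move=> [mf [B fB]] [mg [C gC]]; split; first exact: measurable_funB.
exists (B + C) => x Dx.
by rewrite (le_trans (ler_normB _ _))// lerD ?fB ?gC.
Qed.

Lemma bounded_mfun_cst (d : measure_display) (T : measurableType d)
    (R : realType) (D : set T) (c : R) : bounded_mfun D (fun=> c).
Proof. by split => //; exists `|c|. Qed.

Lemma bounded_mfun01 (d : measure_display) (T : measurableType d)
    (R : realType) (D : set T) (f : T -> R) :
  measurable_fun D f -> (forall x, f x = 0 \/ f x = 1) -> bounded_mfun D f.
Proof.
move=> mf f01; split => //; exists 1 => x _.
by case: (f01 x) => ->; rewrite ?normr0 ?normr1.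
Qed.

Lemma bounded_mfunD (d : measure_display) (T : measurableType d)
    (R : realType) (D : set T) (f g : T -> R) :
  bounded_mfun D f -> bounded_mfun D g -> bounded_mfun D (fun x => f x + g x).
Proof.
move=> [mf [B fB]] [mg [C gC]]; split; first exact: measurable_funD.
exists (B + C) => x Dx.
by rewrite (le_trans (ler_normD _ _))// lerD ?fB ?gC.
Qed.

Lemma bounded_mfunX (d : measure_display) (T : measurableType d)
    (R : realType) (D : set T) (f : T -> R) (n : nat) :
  bounded_mfun D f -> bounded_mfun D (fun x => f x ^+ n).
Proof.
move=> bf; elim: n => [|n IHn].
  by under eq_fun do rewrite expr0; exact: bounded_mfun_cst.
by under eq_fun do rewrite exprS; exact: bounded_mfunM.
Qed.

Lemma bounded_mfun_sum (d : measure_display) (T : measurableType d)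
    (R : realType) (D : set T) (I : Type) (s : seq I) (f : I -> T -> R) :
  (forall i, bounded_mfun D (f i)) ->
  bounded_mfun D (fun x => \sum_(i <- s) f i x).
Proof.
move=> bf; elim: s => [|i s IHs].
  by under eq_fun do rewrite big_nil; exact: bounded_mfun_cst.
by under eq_fun do rewrite big_cons; exact: bounded_mfunD.
Qed.

Lemma bounded_mfun_lim (d : measure_display) (T : measurableType d)
    (R : realType) (D : set T) (f_ : nat -> T -> R) (f : T -> R) (B : R) :
  (forall n, measurable_fun D (f_ n)) ->
  (forall n x, D x -> `|f_ n x| <= B) ->
  (forall x, D x -> f_ ^~ x @ \oo --> f x) -> bounded_mfun D f.
Proof.
move=> mf_ f_B f_f; split; first exact: (measurable_fun_cvg mf_ f_f).
exists B => x Dx.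
have cn : (fun n => `|f_ n x|) @ \oo --> `|f x| by apply: cvg_norm; exact: f_f.
rewrite -(cvg_lim _ cn)//; apply: limr_le; first by apply/cvg_ex; eexists; exact: cn.
by apply: nearW => n; exact: f_B.
Qed.

(** * Quadratic forms of kernels and thresholding *)

Section quadratic_form.
Context {d : measure_display} {T : measurableType d} {R : realType}.
Variables (mu : {sigma_finite_measure set T -> \bar R}) (D : set T).
Hypotheses (mD : measurable D) (Dfin : (mu D < +oo)%E).
Variable K : T -> T -> R.
Hypothesis bK : bounded_mfun (D `*` D) (fun p => K p.1 p.2).

(** The iterated form matches [energy] and [convO] by unfolding alone; [bform_prod] supplies the
    joint integral, on which sums and limits of kernels are handled. *)
Definition bform (v w : T -> R) : R :=
  Rintegral mu D (fun x => v x * Rintegral mu D (fun y => K x y * w y)).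

Lemma bounded_mfun_integrable (f : T -> R) :
  bounded_mfun D f -> mu.-integrable D (EFin \o f).
Proof. by move=> [mf [B fB]]; exact: bounded_fun_integrable fB. Qed.

Lemma bounded_mfun_fst (v : T -> R) :
  bounded_mfun D v -> bounded_mfun (D `*` D) (fun p : T * T => v p.1).
Proof.
move=> [mv [B vB]]; split; last by exists B => p [Dp _]; exact: vB.
apply: (measurable_comp mD _ mv).
  by move=> _ [p [Dp _] <-].
by apply: measurable_funTS; exact: measurable_fst.
Qed.

Lemma bounded_mfun_snd (v : T -> R) :
  bounded_mfun D v -> bounded_mfun (D `*` D) (fun p : T * T => v p.2).
Proof.
move=> [mv [B vB]]; split; last by exists B => p [_ Dp]; exact: vB.
apply: (measurable_comp mD _ mv).
  by move=> _ [p [_ Dp] <-].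
by apply: measurable_funTS; exact: measurable_snd.
Qed.

Lemma bounded_mfun_section (x : T) (w : T -> R) : D x -> bounded_mfun D w ->
  bounded_mfun D (fun y => K x y * w y).
Proof.
move=> Dx bw; apply: bounded_mfunM => //.
have [mK [B KB]] := bK; split; last first.
  by exists B => y Dy; apply: (KB (x, y)).
apply: (measurable_comp _ _ mK (_ : measurable_fun D (fun y => (x, y)))).
- exact: measurableX.
- by move=> _ [y Dy <-].
- by apply: measurable_funTS; exact: pair1_measurable.
Qed.

Lemma measurable_potential (w : T -> R) : bounded_mfun D w ->
  measurable_fun D (fun x => Rintegral mu D (fun y => K x y * w y)).
Proof.
move=> bw; have [mKw [B KwB]] := bounded_mfunM bK (bounded_mfun_snd bw).
exact: (measurable_bounded_section mD Dfin mKw KwB).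
Qed.

Lemma bounded_potential (w : T -> R) : bounded_mfun D w ->
  bounded_mfun D (fun x => Rintegral mu D (fun y => K x y * w y)).
Proof.
move=> bw; split; first exact: measurable_potential.
have [_ [B KwB]] := bounded_mfunM bK (bounded_mfun_snd bw).
exists (B * fine (mu D)) => x Dx.
have iK := bounded_mfun_integrable (bounded_mfun_section Dx bw).
rewrite (le_trans (le_normr_Rintegral mD iK))// -Rintegral_cst//.
apply: le_Rintegral => //.
- exact: integrable_norm iK.
- by apply: bounded_mfun_integrable; exact: bounded_mfun_cst.
- by move=> y Dy; apply: (KwB (x, y)).
Qed.

Lemma bform_prod (v w : T -> R) : bounded_mfun D v -> bounded_mfun D w ->
  bform v w =
  Rintegral (mu \x mu)%E (D `*` D) (fun p => v p.1 * (K p.1 p.2 * w p.2)).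
Proof.
move=> bv bw.
have [mf [B fB]] := bounded_mfunM (bounded_mfun_fst bv)
  (bounded_mfunM bK (bounded_mfun_snd bw)).
rewrite -(bounded_fubini12 mD Dfin mf fB); apply: eq_Rintegral => x /set_mem Dx.
by rewrite -RintegralZl//; exact/bounded_mfun_integrable/bounded_mfun_section.
Qed.

Lemma bformBl (v1 v2 w : T -> R) :
  bounded_mfun D v1 -> bounded_mfun D v2 -> bounded_mfun D w ->
  bform (fun x => v1 x - v2 x) w = bform v1 w - bform v2 w.
Proof.
move=> b1 b2 bw; have bp := bounded_potential bw.
rewrite /bform -RintegralB//; last 2 first.
- exact/bounded_mfun_integrable/bounded_mfunM.
- exact/bounded_mfun_integrable/bounded_mfunM.
by apply: eq_Rintegral => x _; rewrite mulrBl.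
Qed.

Lemma bformBr (v w1 w2 : T -> R) :
  bounded_mfun D v -> bounded_mfun D w1 -> bounded_mfun D w2 ->
  bform v (fun x => w1 x - w2 x) = bform v w1 - bform v w2.
Proof.
move=> bv b1 b2; rewrite /bform -RintegralB//; last 2 first.
- by apply/bounded_mfun_integrable/bounded_mfunM => //; exact: bounded_potential.
- by apply/bounded_mfun_integrable/bounded_mfunM => //; exact: bounded_potential.
apply: eq_Rintegral => x /set_mem Dx; rewrite -mulrBr -RintegralB//; last 2 first.
- exact/bounded_mfun_integrable/bounded_mfun_section.
- exact/bounded_mfun_integrable/bounded_mfun_section.
by congr (_ * _); apply: eq_Rintegral => y _; rewrite mulrBr.
Qed.

(** Integrating in the other order swaps the variables, and symmetry of [K] restores the kernel. *)
Lemma bformC (v w : T -> R) : (forall x y, K x y = K y x) ->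
  bounded_mfun D v -> bounded_mfun D w -> bform v w = bform w v.
Proof.
move=> KC bv bw; rewrite bform_prod//.
have [mf [B fB]] := bounded_mfunM (bounded_mfun_fst bv)
  (bounded_mfunM bK (bounded_mfun_snd bw)).
rewrite -(bounded_fubini21 mD Dfin mf fB); apply: eq_Rintegral => y /set_mem Dy /=.
rewrite -RintegralZl//; last exact/bounded_mfun_integrable/bounded_mfun_section.
by apply: eq_Rintegral => x _; rewrite KC; ring.
Qed.

Section thresholding.
Variables (F1 F2 : T -> R) (c : R) (v w : T -> R).
Hypotheses (iF1 : mu.-integrable D (EFin \o F1)).
Hypotheses (iF2 : mu.-integrable D (EFin \o F2)).
Hypotheses (c0 : 0 <= c) (mw : measurable_fun D w).
Hypotheses (w01 : forall x, w x = 0 \/ w x = 1).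
(** The first variation of the energy at [w]: for symmetric [K], the derivative of B(u, 1 - u) at u
    = w in direction d is B(d, 1 - w) - B(w, d) = B(d, 1 - 2w). *)
Let phi (x : T) : R :=
  F1 x - F2 x + c * Rintegral mu D (fun y => K x y * (1 - 2 * w y)).
Hypothesis vE : forall x, v x = if phi x <= 0 then 1 else 0.

Let bw : bounded_mfun D w. Proof. exact: bounded_mfun01. Qed.

Let b12w : bounded_mfun D (fun y => 1 - 2 * w y).
Proof.
apply: bounded_mfunB; first exact: bounded_mfun_cst.
by apply: bounded_mfunM => //; exact: bounded_mfun_cst.
Qed.

(** Measurability passes from [w] to [v] because the potential of a bounded measurable function is
    measurable, by Fubini. *)
Lemma measurable_threshold : measurable_fun D v.
Proof.
rewrite (funext vE); apply: measurable_fun_if => //.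
apply: measurable_fun_ler => //.
apply: measurable_funD.
  apply: measurable_funB.
    by case/integrableP: iF1 => /measurable_EFinP.
  by case/integrableP: iF2 => /measurable_EFinP.
by apply: measurable_funM => //; exact: measurable_potential.
Qed.

Lemma threshold_binary x : v x = 0 \/ v x = 1.
Proof. by rewrite vE; case: ifP; [right|left]. Qed.

Let bv : bounded_mfun D v.
Proof. exact: (bounded_mfun01 measurable_threshold threshold_binary). Qed.

Let integrableM (f g : T -> R) : bounded_mfun D f -> mu.-integrable D (EFin \o g) ->
  mu.-integrable D (EFin \o (fun x => f x * g x)).
Proof.
move=> [mf [B fB]] ig; apply: (@integrableMr _ _ _ _ _ mD f (EFin \o g)) => //.
exists B; split; first exact: num_real.
by move=> M BM x Dx; apply: (le_trans (fB x Dx)); exact: ltW.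
Qed.

Hypothesis KC : forall x y, K x y = K y x.
Hypothesis Kpsd : forall u, bounded_mfun D u -> 0 <= bform u u.

(* The interaction term is concave, so it lies below its linearization at [w],
   and [v] minimizes the linearized energy pointwise. *)
Lemma threshold_energy_le :
  Rintegral mu D (fun x => v x * F1 x + (1 - v x) * F2 x) +
    c * bform v (fun y => 1 - v y) <=
  Rintegral mu D (fun x => w x * F1 x + (1 - w x) * F2 x) +
    c * bform w (fun y => 1 - w y).
Proof.
have b1 : bounded_mfun D (fun=> 1 : R) by exact: bounded_mfun_cst.
have iF u : bounded_mfun D u ->
    mu.-integrable D (EFin \o (fun x => u x * F1 x + (1 - u x) * F2 x)).
  move=> bu; have i1 := integrableM bu iF1.
  have i2 := integrableM (bounded_mfunB b1 bu) iF2.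
  exact: (integrableD mD i1 i2).
have bd := bounded_mfunB bv bw.
have bp := bounded_potential b12w.
have idp := bounded_mfun_integrable (bounded_mfunM bd bp).
(* The left side is the integral of (v - w) phi. Its sign is reversed below so that nonnegativity of
   the integrand suffices. *)
have lin : Rintegral mu D (fun x => v x * F1 x + (1 - v x) * F2 x) -
    Rintegral mu D (fun x => w x * F1 x + (1 - w x) * F2 x) +
    c * bform (fun x => v x - w x) (fun y => 1 - 2 * w y) <= 0.
  rewrite -RintegralB; [|by []|exact: iF..].
  have i1 : mu.-integrable D (EFin \o (fun x =>
      v x * F1 x + (1 - v x) * F2 x - (w x * F1 x + (1 - w x) * F2 x))).
    exact: (integrableB mD (iF _ bv) (iF _ bw)).
  have i2 : mu.-integrable D (EFin \o (fun x =>
      c * ((v x - w x) * Rintegral mu D (fun y => K x y * (1 - 2 * w y))))).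
    exact: (integrableZl mD c idp).
  rewrite /bform -RintegralZl// -RintegralD//.
  rewrite -oppr_ge0 -mulN1r -RintegralZl//; last exact: (integrableD mD i1 i2).
  apply: Rintegral_ge0 => x Dx.
  have -> : -1 * (v x * F1 x + (1 - v x) * F2 x -
      (w x * F1 x + (1 - w x) * F2 x) + c * ((v x - w x) *
      Rintegral mu D (fun y => K x y * (1 - 2 * w y)))) = (w x - v x) * phi x.
    by rewrite /phi; ring.
  (* Where phi <= 0, v = 1 and w - v <= 0; elsewhere v = 0 and w - v = w >= 0. *)
  rewrite vE; case: ifPn => [phi_le0|]; last rewrite -ltNge => /ltW phi_ge0.
    by apply: mulr_le0 => //; case: (w01 x) => ->; lra.
  by apply: mulr_ge0 => //; case: (w01 x) => ->; lra.
have Q0 := Kpsd bd.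
have b1w := bounded_mfunB b1 bw.
have E1 : (fun y => 1 - 2 * w y) = (fun y => (1 - w y) - w y).
  by apply/funext => y; ring.
have b1ww := bounded_mfunB b1w bw.
move: lin Q0; rewrite E1.
(* Everything expands into B(a, b) with a among v, w and b among 1, v, w. The energy difference is
   then the left side of [lin] minus c B(d, d), where d = v - w. *)
rewrite !(bformBr, bformBl)// (bformC KC bw bv) => lin Q0.
have := mulr_ge0 c0 Q0; lra.
Qed.

End thresholding.
End quadratic_form.

(** * Positive semidefinite kernels: closure under bounded limits and sums *)

Section psd_kernel.
Context {d : measure_display} {T : measurableType d} {R : realType}.
Variables (mu : {sigma_finite_measure set T -> \bar R}) (D : set T).
Hypotheses (mD : measurable D) (Dfin : (mu D < +oo)%E).

(** Boundedness is included so that Fubini applies to the form and the property can be carried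
    through sums and limits. *)
Definition psd_kernel (K : T -> T -> R) :=
  bounded_mfun (D `*` D) (fun p => K p.1 p.2) /\
  forall u, bounded_mfun D u -> 0 <= bform mu D K u u.

Lemma psd_kernel_lim (K_ : nat -> T -> T -> R) (K : T -> T -> R) (B : R) :
  (forall n, psd_kernel (K_ n)) ->
  (forall n x y, D x -> D y -> `|K_ n x y| <= B) ->
  (forall x y, D x -> D y -> (fun n => K_ n x y) @ \oo --> K x y) ->
  psd_kernel K.
Proof.
move=> psdK KB Kcvg.
have mDD : measurable (D `*` D) by exact: measurableX.
have bK : bounded_mfun (D `*` D) (fun p => K p.1 p.2).
  apply: (bounded_mfun_lim (f_ := fun n p => K_ n p.1 p.2) (B := B)).
  - by move=> n; case: (psdK n) => -[].
  - by move=> n p [Dx Dy]; exact: KB.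
  - by move=> p [Dx Dy]; exact: Kcvg.
split=> // u bu; rewrite bform_prod//.
have [_ [U uU]] := bu.
(* The majorant combines the bound [U] of |u|, used twice, with the bound [B] of the kernels. *)
apply: (@Rintegral_lim_ge0 _ _ _ _ _
  (fun n p => u p.1 * (K_ n p.1 p.2 * u p.2)) _ (U * (B * U)) mDD).
- exact: square_fin.
- move=> n; have [bKn _] := psdK n.
  by have [] := bounded_mfunM (bounded_mfun_fst mD bu)
    (bounded_mfunM bKn (bounded_mfun_snd mD bu)).
- move=> n p [Dx Dy]; rewrite !normrM.
  by rewrite !ler_pM ?mulr_ge0 ?uU ?KB.
- move=> p [Dx Dy]; apply: cvgMl_tmp; apply: cvgMr_tmp; exact: Kcvg.
- move=> n; have [bKn Kn0] := psdK n.
  by rewrite -bform_prod//; exact: Kn0.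
Qed.

Lemma psd_kernelD (K1 K2 : T -> T -> R) :
  psd_kernel K1 -> psd_kernel K2 -> psd_kernel (fun x y => K1 x y + K2 x y).
Proof.
move=> [b1 p1] [b2 p2]; have b12 := bounded_mfunD b1 b2.
split=> // u bu; rewrite bform_prod//.
have integrable_term K : bounded_mfun (D `*` D) (fun p => K p.1 p.2) ->
    (mu \x mu)%E.-integrable (D `*` D)
      (EFin \o (fun p => u p.1 * (K p.1 p.2 * u p.2))).
  move=> bK; have [mf [B fB]] := bounded_mfunM (bounded_mfun_fst mD bu)
    (bounded_mfunM bK (bounded_mfun_snd mD bu)).
  exact: bounded_integrable_prod fB.
under eq_Rintegral do rewrite mulrDl mulrDr.
rewrite RintegralD; last 3 first.
- exact: measurableX.
- exact: integrable_term.
- exact: integrable_term.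
by rewrite -!bform_prod// addr_ge0// ?p1 ?p2.
Qed.

(** The form is c times the square of the integral of h u. *)
Lemma psd_kernel_rank1 (c : R) (h : T -> R) : 0 <= c -> bounded_mfun D h ->
  psd_kernel (fun x y => c * (h x * h y)).
Proof.
move=> c0 bh; split.
  apply: bounded_mfunM; first exact: bounded_mfun_cst.
  by apply: bounded_mfunM; [exact: bounded_mfun_fst|exact: bounded_mfun_snd].
move=> u bu; rewrite /bform; have bhu := bounded_mfunM bh bu.
have -> : Rintegral mu D (fun x => u x *
    Rintegral mu D (fun y => c * (h x * h y) * u y)) =
    Rintegral mu D (fun x => (c * Rintegral mu D (fun y => h y * u y)) *
      (h x * u x)).
  apply: eq_Rintegral => x _.
  under eq_Rintegral do rewrite -!mulrA mulrA.
  by rewrite RintegralZl//; [ring|exact: bounded_mfun_integrable].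
rewrite RintegralZl//; last exact: bounded_mfun_integrable.
by rewrite -mulrA mulr_ge0// -expr2 sqr_ge0.
Qed.

Lemma psd_kernel_sum (I : Type) (s : seq I) (c : I -> R) (h : I -> T -> R) :
  (forall i, 0 <= c i) -> (forall i, bounded_mfun D (h i)) ->
  psd_kernel (fun x y => \sum_(i <- s) c i * (h i x * h i y)).
Proof.
move=> c0 bh; elim: s => [|i s IHs].
  (* The empty sum is presented as a rank-one kernel with zero coefficient. *)
  rewrite (_ : (fun _ _ => _) = (fun _ _ => 0 * (0 * 0))); last first.
    by apply/funext => x; apply/funext => y; rewrite big_nil mul0r.
  by apply: (@psd_kernel_rank1 0 (fun=> 0)) => //; exact: bounded_mfun_cst.
rewrite (_ : (fun _ _ => _) = (fun x y => c i * (h i x * h i y) +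
    \sum_(i <- s) c i * (h i x * h i y))); last first.
  by apply/funext => x; apply/funext => y; rewrite big_cons.
by apply: psd_kernelD => //; exact: psd_kernel_rank1.
Qed.

End psd_kernel.

(** * Fejer means of double series *)

(** Each element of [r] is removed from [s] in turn; since [r] is duplicate-free, its remaining
    elements survive in what is left of [s]. *)
Lemma ler_sum_seq_sub (R : numDomainType) (T : eqType) (a : T -> R)
    (r s : seq T) :
  uniq r -> {subset r <= s} -> (forall t, 0 <= a t) ->
  \sum_(t <- r) a t <= \sum_(t <- s) a t.
Proof.
move=> + + a0; elim: r s => [|x r IHr] s /=; first by rewrite big_nil sumr_ge0.
move=> /andP[xr ur] rs; have xs : x \in s by apply: rs; rewrite mem_head.
rewrite (perm_big _ (perm_to_rem xs)) /= !big_cons lerD2l; apply: IHr => // y yr.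
have : y \in s by apply: rs; rewrite in_cons yr orbT.
rewrite (perm_mem (perm_to_rem xs)) in_cons => /orP[/eqP yx|//].
by move: xr; rewrite -yx yr.
Qed.

(** Repeated values of [h], and values outside [A], only increase the right side. *)
Lemma fsum_le_cover (R : realType) (T : choiceType) (I : finType)
    (h : I -> T) (a : T -> R) (A : set T) :
  finite_set A -> (forall t, A t -> exists i, h i = t) ->
  (forall t, 0 <= a t) ->
  (\sum_(t \in A) (a t)%:E <= (\sum_i a (h i))%:E)%E.
Proof.
move=> finA Ah a0.
rewrite fsbig_finite// sumEFin lee_fin -(big_map h xpredT a).
apply: ler_sum_seq_sub => // t; rewrite in_fset_set// inE => /Ah[i <-].
by apply: map_f; rewrite mem_index_enum.
Qed.

Lemma sum_le_esum (R : realType) (T : choiceType) (I : finType)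
    (h : I -> T) (a : T -> R) : injective h ->
  ((\sum_i a (h i))%:E <= \esum_(t in [set: T]) (a t)%:E)%E.
Proof.
move=> hinj; apply: esum_ge; exists [set` map h (index_enum I)].
  by split=> //; exact: finite_seq.
rewrite -fsbig_seq ?map_inj_uniq ?index_enum_uniq// big_map sumEFin.
exact: lexx.
Qed.

Lemma finite_set_int2_bounded (A : set (int * int)) : finite_set A ->
  exists M : nat, forall m, A m -> (`|m.1| <= M)%N /\ (`|m.2| <= M)%N.
Proof.
move=> /finite_seqP[s ->]; exists (\max_(m <- s) (`|m.1| + `|m.2|))%N => m ms.
have : (`|m.1| + `|m.2| <= \max_(m <- s) (`|m.1| + `|m.2|))%N.
  exact: leq_bigmax_seq.
lia.
Qed.

Section fejer_mean.
Variables (R : realType) (a : int * int -> R).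
Hypothesis a_ge0 : forall m, 0 <= a m.

Definition box_diff (N : nat) (n n' : 'I_N * 'I_N) : int * int :=
  (n.1%:Z - n'.1%:Z, n.2%:Z - n'.2%:Z).

(** Grouping pairs by their difference m gives [a m] the Fejer weight (1 - |m.1|/(N+1))(1 -
    |m.2|/(N+1)), or 0 outside the box. The ungrouped double sum is what exhibits positive
    semidefiniteness. *)
Definition fejer_mean (N : nat) : R :=
  (N.+1%:R ^- 2) * \sum_(n' : 'I_N.+1 * 'I_N.+1) \sum_(n : 'I_N.+1 * 'I_N.+1)
    a (box_diff n n').

Lemma fejer_mean_ge0 N : 0 <= fejer_mean N.
Proof.
rewrite mulr_ge0 ?invr_ge0 ?exprn_ge0//.
by apply: sumr_ge0 => n' _; exact: sumr_ge0.
Qed.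

Hypothesis a_fin : \esum_(m in [set: int * int]) (a m)%:E \is a fin_num.
Let s : R := fine (\esum_(m in [set: int * int]) (a m)%:E).

(** For fixed n' the map from n to n - n' is injective, so each of the (N+1)^2 inner sums is at most
    [s]. *)
Lemma fejer_mean_le N : fejer_mean N <= s.
Proof.
rewrite /fejer_mean mulrC ler_pdivrMr ?exprn_gt0 ?ltr0n//.
rewrite (_ : N.+1%:R ^+ 2 = \sum_(n' : 'I_N.+1 * 'I_N.+1) 1); last first.
  by rewrite sumr_const card_prod card_ord natrM expr2.
rewrite mulr_sumr ler_sum// => n' _; rewrite mulr1 -lee_fin fineK//.
apply: sum_le_esum => -[n1 n2] [m1 m2] [e1 e2].
by congr pair; apply: val_inj => /=; lia.
Qed.

(** Counts the positions from which every step of length at most [M] stays inside the box. *)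
Lemma card_interior (M n : nat) :
  (n - M.*2 <= #|[pred i : 'I_n | (M <= i) && (i + M < n)]|)%N.
Proof.
rewrite -sum1_card /= (eq_bigl (fun i : 'I_n => (M <= i) && (i + M < n))%N)//.
rewrite -(big_mkord (fun i => (M <= i) && (i + M < n))%N (fun=> 1%N)).
have [le_nM|lt_Mn] := leqP n M.*2; first by rewrite (eqP (_ : n - M.*2 == 0)%N).
suff -> : (\sum_(0 <= i < n | (M <= i) && (i + M < n)) 1 =
    \sum_(M <= i < n - M) 1)%N.
  by rewrite sum_nat_const_nat muln1; lia.
rewrite (big_nat_widenl M 0)// (big_nat_widen _ (n - M) n)//; last by lia.
rewrite !big_mkord.
by apply: eq_bigl => i /=; lia.
Qed.

(** A finite set [A] carries the sum up to e/2. Every inner sum with n' at distance at least [M]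
    from the border covers [A], and the proportion of such n' tends to 1. *)
Lemma cvg_fejer_mean : fejer_mean @ \oo --> s.
Proof.
apply/cvgrPdist_le => /= e e0.
have e20 : 0 < e / 2 by lra.
have [_ [A [finA _] <-]] := ub_ereal_sup_adherent e20 a_fin.
set E := ereal_sup _.
have -> : E = s%:E by rewrite /s fineK.
have [M AM] := finite_set_int2_bounded finA.
rewrite fsbig_finite// sumEFin -EFinB lte_fin.
set sA := \sum_(_ <- _) _ => sA_gt.
have sA0 : 0 <= sA by exact: sumr_ge0.
near=> N.
(* At most 4M(N+1) of the (N+1)^2 inner sums are lost, which costs 4M sA/(N+1); this is at most e/2
   once N+1 >= 8M sA/e. *)
have N_large : 8 * M%:R * sA / e <= N%:R.
  near: N; exact: nbhs_infty_ger.
rewrite ger0_norm ?subr_ge0 ?fejer_mean_le//.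
pose good (i : 'I_N.+1) := (M <= i)%N && (i + M < N.+1)%N.
pose k := #|[pred i : 'I_N.+1 | good i]|.
have row_ge n' : good n'.1 -> good n'.2 ->
    sA <= \sum_(n : 'I_N.+1 * 'I_N.+1) a (box_diff n n').
  move=> /andP[g1 g1'] /andP[g2 g2'].
  rewrite -lee_fin -sumEFin -fsbig_finite//; apply: fsum_le_cover => // -[m1 m2].
  move=> /AM[/= m1M m2M].
  (* The preimage of m is n = n' + m. Its coordinates are nonnegative because n' is interior, so
     [absz] leaves them unchanged. *)
  have l1 : (absz ((n'.1)%:Z + m1)%R < N.+1)%N by lia.
  have l2 : (absz ((n'.2)%:Z + m2)%R < N.+1)%N by lia.
  exists (Ordinal l1, Ordinal l2); rewrite /box_diff /=; congr pair; lia.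
have dbl_ge : k%:R ^+ 2 * sA <=
    \sum_(n' : 'I_N.+1 * 'I_N.+1) \sum_(n : 'I_N.+1 * 'I_N.+1) a (box_diff n n').
  rewrite (bigID (fun n' : 'I_N.+1 * 'I_N.+1 => good n'.1 && good n'.2)) /=.
  rewrite -[leLHS]addr0; apply: lerD; last first.
    by apply: sumr_ge0 => ? _; exact: sumr_ge0.
  apply: (@le_trans _ _ (\sum_(n' : 'I_N.+1 * 'I_N.+1 | good n'.1 && good n'.2) sA)).
    rewrite -(pair_big good good (fun _ _ => sA)) /=.
    by rewrite !sumr_const -/k -mulrnA -[sA *+ _]mulr_natl natrM expr2.
  by apply: ler_sum => n' /andP[]; exact: row_ge.
have k_ge : N.+1%:R ^+ 2 - 4 * M%:R * N.+1%:R <= k%:R ^+ 2 :> R.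
  have /= := card_interior M N.+1; rewrite -/good -/k => kM.
  (* When N+1 < 2M the truncated count is 0, but then the left side is negative; otherwise the bound
     k >= N+1-2M is squared. *)
  have [lt_NM|le_MN] := ltnP N.+1 M.*2.
    apply: (@le_trans _ _ 0); last exact: exprn_ge0.
    have : N.+1%:R <= 2 * M%:R :> R by rewrite -natrM ler_nat; lia.
    have : 0 <= N.+1%:R :> R by [].
    nra.
  have : N.+1%:R - 2 * M%:R <= k%:R :> R.
    by rewrite lerBlDr -natrM -natrD ler_nat; lia.
  have : 2 * M%:R <= N.+1%:R :> R by rewrite -natrM ler_nat; lia.
  have : 0 <= M%:R :> R by [].
  nra.
have N0 : 0 < N.+1%:R :> R by rewrite ltr0n.
have : sA - e / 2 <= fejer_mean N.
  rewrite /fejer_mean [leRHS]mulrC ler_pdivlMr ?exprn_gt0//; apply: le_trans dbl_ge.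
  have : 8 * M%:R * sA <= e * N.+1%:R.
    by rewrite [leRHS]mulrC -ler_pdivrMr// (le_trans N_large)// ler_nat.
  move: k_ge => /(ler_wpM2r sA0); nra.
lra.
Unshelve. all: by end_near. Qed.

End fejer_mean.

(** * The periodic heat kernel *)

Lemma sum_geometric_le (R : realFieldType) (q : R) (n : nat) :
  0 <= q -> q < 1 -> \sum_(i < n) q ^+ i <= (1 - q)^-1.
Proof.
move=> q0 q1; have q10 : 0 < 1 - q by rewrite subr_gt0.
rewrite -[leRHS]mul1r ler_pdivlMr// mulrC.
rewrite -opprB mulNr -subrX1 opprB lerBlDr lerDl; exact: exprn_ge0.
Qed.

Section heat_kernel.
Variables (R : realType) (tau : R).
Hypothesis tau_gt0 : 0 < tau.

Definition gaussian2 (x : R * R) : R :=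
  1 / (4 * pi * tau) * expR (- ((x.1 ^+ 2 + x.2 ^+ 2) / (4 * tau))).

Definition lattice_shift (x : R * R) (m : int * int) : R * R :=
  (x.1 + 2 * pi * m.1%:~R, x.2 + 2 * pi * m.2%:~R).

Lemma heat_kernelE (x : R * R) : heat_kernel tau x =
  fine (\esum_(m in [set: int * int]) (gaussian2 (lattice_shift x m))%:E).
Proof. by []. Qed.

Let pi2_gt0 : 0 < 2 * pi :> R. Proof. by rewrite mulr_gt0// pi_gt0. Qed.
Let c_ge0 : 0 <= 1 / (4 * pi * tau) :> R.
Proof. by rewrite divr_ge0// mulr_ge0 ?mulr_ge0 ?pi_ge0// ltW. Qed.
Let tau4_gt0 : 0 < 4 * tau. Proof. by rewrite mulr_gt0. Qed.

Lemma gaussian2_ge0 x : 0 <= gaussian2 x.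
Proof. by rewrite mulr_ge0// expR_ge0. Qed.

(** The lattice is invariant under m -> -m and the Gaussian is even; this yields the symmetry of the
    convolution kernel. *)
Lemma heat_kernelN (x : R * R) : heat_kernel tau (- x) = heat_kernel tau x.
Proof.
rewrite !heat_kernelE; congr fine.
rewrite (@reindex_esum R _ _ [set: int * int] [set: int * int]
  (fun m => (- m.1, - m.2))); last first.
  split=> //.
    by move=> [a b] [c e] _ _ [/oppr_inj -> /oppr_inj ->].
  by move=> [a b] _; exists (- a, - b) => //=; rewrite !opprK.
apply: eq_esum => m _; rewrite /gaussian2 /lattice_shift /=.
by rewrite !mulrNz !mulrN -!opprD !sqrrN.
Qed.

(** With s = 2 pi and |t| <= s, (t + s k)^2 and (t - s k)^2 are at least s^2 (k^2 - 2k), hence at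
    least s^2 (2k - 4) as (k - 2)^2 >= 0. The linear exponent gives the ratio [q] and the constant
    [C]. *)
Let q : R := expR (- (2 * (2 * pi) ^+ 2 / (4 * tau))).
Let C : R := expR (4 * (2 * pi) ^+ 2 / (4 * tau)).

Lemma gaussian_shift_le (t : R) (b : bool) (k : nat) : `|t| <= 2 * pi ->
  expR (- ((t + 2 * pi * (if b then k%:Z else - k%:Z)%:~R) ^+ 2 / (4 * tau))) <=
  C * q ^+ k.
Proof.
move=> t_le; rewrite -expRM_natr -expRD ler_expR.
rewrite [leRHS](_ : _ = - ((2 * pi) ^+ 2 * (2 * k%:R - 4) / (4 * tau))); last by ring.
rewrite lerN2 ler_pM2r ?invr_gt0//.
have -> : (if b then k%:Z else - k%:Z)%:~R = (if b then k%:R else - k%:R) :> R.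
  by case: b; rewrite ?mulrNz -pmulrn.
have /andP[t_ge {}t_le] : - (2 * pi) <= t <= 2 * pi by rewrite -ler_norml.
have k0 : 0 <= k%:R :> R by [].
move: t_ge t_le pi2_gt0 k0; move: (2 * pi) k%:R => s r t_ge t_le s_gt0 r_ge0.
have sr_ge0 : 0 <= s * r by rewrite mulr_ge0// ltW.
have sr2 : 0 <= s ^+ 2 * (r - 2) ^+ 2 by rewrite mulr_ge0// sqr_ge0.
have t2 := sqr_ge0 t.
have p1 : 0 <= (s * r) * (s + t).
  by apply: mulr_ge0 => //; lra.
have p2 : 0 <= (s * r) * (s - t).
  by apply: mulr_ge0 => //; lra.
by case: b; nra.
Qed.

(** The Gaussian factors over the coordinates, and each one-dimensional sum is dominated by two
    geometric series, one per sign. The range 2 pi covers differences of points of the fundamental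
    domain. *)
Lemma heat_esum_bounded : exists B : R, forall x : R * R,
  `|x.1| <= 2 * pi -> `|x.2| <= 2 * pi ->
  (\esum_(m in [set: int * int]) (gaussian2 (lattice_shift x m))%:E <= B%:E)%E.
Proof.
have q_ge0 : 0 <= q by exact: expR_ge0.
have q_lt1 : q < 1.
  rewrite expR_lt1 oppr_lt0 divr_gt0// mulr_gt0// exprn_gt0//; exact: pi2_gt0.
have C_ge0 : 0 <= C by exact: expR_ge0.
exists (1 / (4 * pi * tau) * (C * (2 * (1 - q)^-1)) ^+ 2) => x x1 x2.
apply: ge_ereal_sup => _ [A [finA _] <-].
have [M AM] := finite_set_int2_bounded finA.
(* Integers as sign and magnitude; 0 is encoded twice, which is harmless for an upper bound. *)
pose sgn (p : bool * 'I_M.+1) : int :=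
  if p.1 then (p.2 : nat)%:Z else - (p.2 : nat)%:Z.
have sgn_onto (m : int) : (`|m| <= M)%N -> exists p, sgn p = m.
  move=> mM; have lt_mM : (`|m| < M.+1)%N by [].
  by exists (0 <= m, Ordinal lt_mM); rewrite /sgn /=; case: ifP; lia.
pose h (p : (bool * 'I_M.+1) * (bool * 'I_M.+1)) := (sgn p.1, sgn p.2).
apply: le_trans (fsum_le_cover (h := h) finA _ _) _.
- move=> [m1 m2] /AM[/= /sgn_onto[p1 <-] /sgn_onto[p2 <-]].
  by exists (p1, p2).
- by move=> m; exact: gaussian2_ge0.
rewrite lee_fin.
pose e1 (t : R) := expR (- (t ^+ 2 / (4 * tau))).
have row_le (t : R) : `|t| <= 2 * pi ->
    \sum_p e1 (t + 2 * pi * (sgn p)%:~R) <= C * (2 * (1 - q)^-1).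
  move=> tle; apply: (@le_trans _ _ (\sum_(p : bool * 'I_M.+1) C * q ^+ p.2)).
    by apply: ler_sum => p _; exact: gaussian_shift_le.
  rewrite -mulr_sumr ler_wpM2l//.
  rewrite -(pair_bigA _ (fun (b : bool) (k : 'I_M.+1) => q ^+ k)) /= big_bool.
  by rewrite mulr_natl mulr2n; apply: lerD; exact: sum_geometric_le.
have row_ge0 (t : R) : 0 <= \sum_p e1 (t + 2 * pi * (sgn p)%:~R).
  by apply: sumr_ge0 => p _; exact: expR_ge0.
rewrite (_ : \sum_i _ = 1 / (4 * pi * tau) *
    ((\sum_p e1 (x.1 + 2 * pi * (sgn p)%:~R)) *
     (\sum_p e1 (x.2 + 2 * pi * (sgn p)%:~R)))); last first.
  rewrite big_distrlr /= pair_bigA mulr_sumr; apply: eq_bigr => p _.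
  by rewrite /gaussian2 /e1 /= -expRD -opprD -mulrDl.
rewrite ler_wpM2l// expr2; apply: ler_pM => //; exact: row_le.
Qed.

Lemma heat_esum_fin (x : R * R) : `|x.1| <= 2 * pi -> `|x.2| <= 2 * pi ->
  \esum_(m in [set: int * int]) (gaussian2 (lattice_shift x m))%:E \is a fin_num.
Proof.
move=> x1 x2; have [B esumB] := heat_esum_bounded.
rewrite ge0_fin_numE; first by rewrite (le_lt_trans (esumB x x1 x2))// ltry.
by apply: esum_ge0 => m _; rewrite lee_fin gaussian2_ge0.
Qed.

Definition fejer_kernel (N : nat) (x : R * R) : R :=
  fejer_mean (fun m => gaussian2 (lattice_shift x m)) N.

End heat_kernel.

(* An alias of [leb2] carrying a sigma-finite structure: on products of measures
   the library's canonical instance only applies to subprobabilities. *)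
Definition plane_measure (R : realType) := leb2 R.
Arguments plane_measure R : clear implicits.

Section plane_measure_sigma_finite.
Variable R : realType.

HB.instance Definition _ := Measure.copy (plane_measure R)
  ((@lebesgue_measure R) \x (@lebesgue_measure R))%E.

(** Squares of an increasing exhaustion: monotonicity puts both coordinates of a point in one common
    [F n]. *)
Lemma plane_measure_sigma_finite : sigma_finite setT (plane_measure R).
Proof.
have /sigma_finiteP[F [TF ndF Foo]] := sigma_finiteT (@lebesgue_measure R).
exists (fun n => F n `*` F n).
  rewrite -setXTT TF predeqE => -[x y]; split.
    move=> [/= [n _ Fnx] [k _ Fky]]; exists (maxn n k) => //; split.
    - by move: x Fnx; exact/subsetPset/ndF/leq_maxl.
    - by move: y Fky; exact/subsetPset/ndF/leq_maxr.
  by move=> [n _ []/= ? ?]; split; exists n.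
move=> k; have [? ?] := Foo k; split; first exact: measurableX.
rewrite /plane_measure /leb2 product_measure1E// lte_mul_pinfty//.
by rewrite ge0_fin_numE.
Qed.

HB.instance Definition _ := Measure_isSigmaFinite.Build _ _ _ (plane_measure R)
  plane_measure_sigma_finite.

End plane_measure_sigma_finite.

(** * The fundamental domain: finite measure and coordinate bounds *)

Section torus.
Variable R : realType.
Notation mu := (plane_measure R).
Notation Om := (Omega R).

Lemma measurable_Omega : measurable Om.
Proof. by apply: measurableX; exact: measurable_itv. Qed.

Lemma plane_measure_Omega_fin : (mu Om < +oo)%E.
Proof.
rewrite /plane_measure /leb2 product_measure1E//= lebesgue_measure_itv /= lte_fin.
rewrite ifT ?mulr_gt0 ?pi_gt0//.
by rewrite oppr0 adde0 -EFinM ltry.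
Qed.

Lemma Omega_fst (x : R * R) : Om x -> `|x.1| <= 2 * pi.
Proof.
move=> [/=]; rewrite in_itv /= => /andP[x0 /ltW xpi] _.
by rewrite ger0_norm.
Qed.

Lemma Omega_snd (x : R * R) : Om x -> `|x.2| <= 2 * pi.
Proof.
move=> [_ /=]; rewrite in_itv /= => /andP[x0 /ltW xpi].
by rewrite ger0_norm.
Qed.

Lemma Omega_sub (x y : R * R) : Om x -> Om y ->
  `|(x - y).1| <= 2 * pi /\ `|(x - y).2| <= 2 * pi.
Proof.
move=> [/=]; rewrite !in_itv /= => /andP[x1 x1'] /andP[x2 x2'].
move=> [/=]; rewrite !in_itv /= => /andP[y1 y1'] /andP[y2 y2'].
by split; rewrite ler_norml; lra.
Qed.

Lemma bounded_mfun_Omega_fst : bounded_mfun Om fst.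
Proof.
split; last by exists (2 * pi); exact: Omega_fst.
by apply: measurable_funTS; exact: measurable_fst.
Qed.

Lemma bounded_mfun_Omega_snd : bounded_mfun Om snd.
Proof.
split; last by exists (2 * pi); exact: Omega_snd.
by apply: measurable_funTS; exact: measurable_snd.
Qed.

End torus.

(** A bound independent of the truncation order, as dominated convergence requires; the partial sums
    at |x| increase to their limit. *)
Lemma series_exp_coeff_norm_le (R : realType) (x : R) (n : nat) :
  `|series (exp_coeff x) n| <= expR `|x|.
Proof.
apply: (@le_trans _ _ (series (exp_coeff `|x|) n)).
  rewrite /series /=; apply: le_trans (ler_norm_sum _ _ _) _.
  by apply: ler_sum => i _; rewrite /exp_coeff /= normrM normrX normfV normr_nat.
apply: nondecreasing_cvgn_le; last exact: is_cvg_series_exp_coeff.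
apply: nondecreasing_series => i _ _; rewrite /exp_coeff /=.
by rewrite mulr_ge0 ?exprn_ge0 ?invr_ge0.
Qed.

(** * Positive semidefiniteness of the Fejer kernels and of the heat kernel *)

Section fejer_kernel_psd.
Variables (R : realType) (tau : R).
Hypothesis tau_gt0 : 0 < tau.
Notation mu := (plane_measure R).
Notation Om := (Omega R).

Let e2 (X : R * R) : R := expR (- ((X.1 ^+ 2 + X.2 ^+ 2) / (4 * tau))).
Let c : R := 1 / (4 * pi * tau).

Let c_ge0 : 0 <= c.
Proof. by rewrite divr_ge0// mulr_ge0 ?mulr_ge0 ?pi_ge0// ltW. Qed.

Lemma gaussian2_sub (X Y : R * R) : gaussian2 tau (X - Y) =
  c * (e2 X * e2 Y * (expR (X.1 * Y.1 / (2 * tau)) * expR (X.2 * Y.2 / (2 * tau)))).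
Proof.
rewrite /gaussian2 /e2 -/c -!expRD; congr (_ * expR _) => /=.
by field; rewrite gt_eqF.
Qed.

(** Even with absolute values in the cross terms, the exponents complete to minus a sum of squares
    of |X.i| - |Y.i|. This bounds all Taylor truncations uniformly. *)
Lemma gaussian_cross_le1 (X Y : R * R) :
  e2 X * e2 Y * (expR `|X.1 * Y.1 / (2 * tau)| * expR `|X.2 * Y.2 / (2 * tau)|) <= 1.
Proof.
rewrite /e2 -!expRD expR_le1 !normrM normfV (gtr0_norm (_ : 0 < 2 * tau)) ?mulr_gt0//.
rewrite -(real_normK (num_real X.1)) -(real_normK (num_real X.2)).
rewrite -(real_normK (num_real Y.1)) -(real_normK (num_real Y.2)).
rewrite [leLHS](_ : _ = - (((`|X.1| - `|Y.1|) ^+ 2 + (`|X.2| - `|Y.2|) ^+ 2) / (4 * tau))).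
  by rewrite oppr_le0 divr_ge0 ?addr_ge0 ?sqr_ge0// mulr_ge0// ltW.
by field; rewrite gt_eqF.
Qed.

Let box_shift N (x : R * R) (n : 'I_N * 'I_N) : R * R :=
  lattice_shift x (n.1%:Z, n.2%:Z).

Lemma lattice_shift_box_diff N (x y : R * R) (n n' : 'I_N * 'I_N) :
  lattice_shift (x - y) (box_diff n n') = box_shift x n - box_shift y n'.
Proof.
rewrite /lattice_shift /box_shift /box_diff /=; congr pair => /=;
  by rewrite intrB; ring.
Qed.

Let coef N J (j : 'I_J * 'I_J) : R := N.+1%:R ^- 2 * c *
  ((2 * tau) ^- j.1 / (j.1)`!%:R * ((2 * tau) ^- j.2 / (j.2)`!%:R)).

(** Each Taylor monomial in X.i Y.i splits into a factor in X and one in Y. As n and n' range over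
    the same box, the same function arises for x and for y, with the nonnegative weight [coef]. *)
Let feature N (j1 j2 : nat) (x : R * R) : R :=
  \sum_(n : 'I_N.+1 * 'I_N.+1) e2 (box_shift x n) *
    ((box_shift x n).1 ^+ j1 * (box_shift x n).2 ^+ j2).

Let trunc_kernel N J (x y : R * R) : R :=
  \sum_(j : 'I_J * 'I_J) coef N j * (feature N j.1 j.2 x * feature N j.1 j.2 y).

Lemma trunc_kernelE N J (x y : R * R) : trunc_kernel N J x y =
  N.+1%:R ^- 2 * \sum_(n' : 'I_N.+1 * 'I_N.+1) \sum_(n : 'I_N.+1 * 'I_N.+1)
    c * (e2 (box_shift x n) * e2 (box_shift y n') *
    (series (exp_coeff ((box_shift x n).1 * (box_shift y n').1 / (2 * tau))) J *
     series (exp_coeff ((box_shift x n).2 * (box_shift y n').2 / (2 * tau))) J)).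
Proof.
rewrite [RHS]mulr_sumr; under [RHS]eq_bigr do rewrite mulr_sumr.
rewrite [RHS]exchange_big /trunc_kernel /=.
under eq_bigr => j _.
  rewrite /feature big_distrlr /= mulr_sumr.
  under eq_bigr do rewrite mulr_sumr.
  over.
rewrite exchange_big; apply: eq_bigr => n _.
rewrite exchange_big; apply: eq_bigr => n' _ /=.
rewrite /series /= !big_mkord big_distrlr /= pair_bigA /= !mulr_sumr.
apply: eq_bigr => j _; rewrite /coef /exp_coeff /=.
by move: (2 * tau) => r; rewrite !exprMn !exprVn; ring.
Qed.

Lemma bounded_mfun_feature N j1 j2 : bounded_mfun Om (feature N j1 j2).
Proof.
apply: bounded_mfun_sum => n.
have b1 : bounded_mfun Om (fun x => (box_shift x n).1).
  apply: bounded_mfunD; first exact: bounded_mfun_Omega_fst.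
  exact: bounded_mfun_cst.
have b2 : bounded_mfun Om (fun x => (box_shift x n).2).
  apply: bounded_mfunD; first exact: bounded_mfun_Omega_snd.
  exact: bounded_mfun_cst.
apply: bounded_mfunM; last by apply: bounded_mfunM; exact: bounded_mfunX.
split; last first.
  exists 1 => x _; rewrite ger0_norm ?expR_ge0// expR_le1 oppr_le0.
  by rewrite divr_ge0 ?addr_ge0 ?sqr_ge0// mulr_ge0// ltW.
have m12 : measurable_fun Om (fun x =>
    ((box_shift x n).1 ^+ 2 + (box_shift x n).2 ^+ 2) / (4 * tau)).
  apply: measurable_funM => //.
  by apply: measurable_funD; [case: (bounded_mfunX 2 b1)|case: (bounded_mfunX 2 b2)].
exact: (measurableT_comp (@measurable_expR R) (measurable_funN m12)).
Qed.

Lemma psd_trunc_kernel N J : psd_kernel mu Om (trunc_kernel N J).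
Proof.
apply: psd_kernel_sum; [exact: measurable_Omega|exact: plane_measure_Omega_fin| |].
  have t_ge0 : 0 <= tau by exact: ltW.
  have coef1_ge0 (k : nat) : 0 <= (2 * tau) ^- k / k`!%:R.
    by rewrite divr_ge0// invr_ge0 exprn_ge0// mulr_ge0.
  move=> j; apply: mulr_ge0; last exact: mulr_ge0.
  by apply: mulr_ge0; rewrite // invr_ge0 exprn_ge0.
by move=> j; exact: bounded_mfun_feature.
Qed.

Lemma psd_fejer_kernel N :
  psd_kernel mu Om (fun x y => fejer_kernel tau N (x - y)).
Proof.
(* By [gaussian_cross_le1] each term of the truncated double sum is at most [c] in absolute value,
   whatever [J]. *)
pose B := N.+1%:R ^- 2 * \sum_(n' : 'I_N.+1 * 'I_N.+1)
  \sum_(n : 'I_N.+1 * 'I_N.+1) c.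
apply: (@psd_kernel_lim _ _ _ (plane_measure R) Om _ _ (trunc_kernel N) _ B).
- exact: measurable_Omega.
- exact: plane_measure_Omega_fin.
- exact: psd_trunc_kernel.
- move=> J x y _ _; rewrite trunc_kernelE normrM ger0_norm ?invr_ge0 ?exprn_ge0//.
  rewrite ler_wpM2l ?invr_ge0 ?exprn_ge0//.
  apply: le_trans (ler_norm_sum _ _ _) _; apply: ler_sum => n' _.
  apply: le_trans (ler_norm_sum _ _ _) _; apply: ler_sum => n _.
  rewrite normrM ger0_norm// -[leRHS]mulr1 ler_wpM2l//.
  apply: le_trans (gaussian_cross_le1 (box_shift x n) (box_shift y n')).
  rewrite normrM ger0_norm ?mulr_ge0 ?expR_ge0//.
  rewrite ler_wpM2l ?mulr_ge0 ?expR_ge0// normrM.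
  by apply: ler_pM => //; exact: series_exp_coeff_norm_le.
- move=> x y _ _; rewrite /fejer_kernel /fejer_mean.
  under eq_fun do rewrite trunc_kernelE.
  apply: cvgMl_tmp.
  apply: cvg_big => [|n' _]; first exact: add_continuous.
  apply: cvg_big => [|n _]; first exact: add_continuous.
  rewrite lattice_shift_box_diff gaussian2_sub.
  apply: cvgMl_tmp; apply: cvgMl_tmp.
  by apply: cvgM; exact: is_cvg_series_exp_coeff.
Qed.

(** Limit in [N]: the Fejer kernels lie between 0 and the heat kernel, which is bounded on
    differences of points of the domain. *)
Lemma psd_heat_kernel : psd_kernel mu Om (fun x y => heat_kernel tau (x - y)).
Proof.
have [B esumB] := heat_esum_bounded tau_gt0.
have hk_le x : `|x.1| <= 2 * pi -> `|x.2| <= 2 * pi -> heat_kernel tau x <= B.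
  move=> x1 x2; rewrite heat_kernelE -lee_fin fineK; last exact: heat_esum_fin.
  exact: esumB.
apply: (@psd_kernel_lim _ _ _ (plane_measure R) Om _ _
  (fun N x y => fejer_kernel tau N (x - y)) _ B).
- exact: measurable_Omega.
- exact: plane_measure_Omega_fin.
- exact: psd_fejer_kernel.
- move=> N x y Dx Dy; have [x1 x2] := Omega_sub Dx Dy.
  rewrite ger0_norm; last by apply: fejer_mean_ge0 => m; exact: gaussian2_ge0.
  apply: le_trans (hk_le _ x1 x2); apply: fejer_mean_le.
  exact: heat_esum_fin.
- move=> x y Dx Dy; have [x1 x2] := Omega_sub Dx Dy.
  apply: cvg_fejer_mean; first by move=> m; exact: gaussian2_ge0.
  exact: heat_esum_fin.
Qed.

End fejer_kernel_psd.

(** * Energy descent along the iteration *)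

Theorem theorem1 (R : realType) (tau lambda : R) (f : R * R -> R)
  (T : Type) (S : set T)
  (F1 F2 : (R * R -> R) -> T -> R * R -> R)
  (u : nat -> R * R -> R) (Theta : nat -> T) :
  0 < tau -> 0 < lambda ->
  (forall th, S th -> (leb2 R).-integrable (Omega R) (EFin \o F1 f th)) ->
  (forall th, S th -> (leb2 R).-integrable (Omega R) (EFin \o F2 f th)) ->
  measurable_fun (Omega R) (u 1%N) ->
  (forall x, u 1%N x = 0 \/ u 1%N x = 1) ->
  (forall k, (1 <= k)%N -> S (Theta k) /\
     forall th, S th ->
       fidelity (F1 f (Theta k)) (F2 f (Theta k)) (u k) <=
       fidelity (F1 f th) (F2 f th) (u k)) ->
  (forall k, (1 <= k)%N -> forall x,
     let phi := F1 f (Theta k) x - F2 f (Theta k) x +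
       lambda * Num.sqrt (pi / tau) *
         convO (heat_kernel tau) (fun y => 1 - 2 * u k y) x in
     u k.+1 x = if phi <= 0 then 1 else 0) ->
  forall k, (1 <= k)%N ->
    energy tau lambda (F1 f (Theta k.+1)) (F2 f (Theta k.+1)) (u k.+1) <=
    energy tau lambda (F1 f (Theta k)) (F2 f (Theta k)) (u k).
Proof.
move=> tau_gt0 lambda_gt0 iF1 iF2 mu1 u1_01 argmin threshold.
have mOm := @measurable_Omega R; have finOm := @plane_measure_Omega_fin R.
have [bK Kpsd] := psd_heat_kernel tau_gt0.
have KC (x y : R * R) : heat_kernel tau (x - y) = heat_kernel tau (y - x).
  by rewrite -opprB heat_kernelN.
have c_ge0 : 0 <= lambda * Num.sqrt (pi / tau).
  by rewrite mulr_ge0 ?sqrtr_ge0// ltW.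
have u_bin k : (1 <= k)%N ->
    measurable_fun (Omega R) (u k) /\ forall x, u k x = 0 \/ u k x = 1.
  (* Iterates start at index 1: index 0 is excluded, and index 1 is the initial datum. *)
  elim: k => [//|[|k] IHk] _; first by [].
  have [mu uk01] := IHk isT; have [S_k _] := argmin k.+1 isT.
  split; last first.
    by move=> x; have /= -> := threshold k.+1 isT x; case: ifP; [right|left].
  exact: (@measurable_threshold _ _ _ (plane_measure R) _ mOm finOm _ bK _ _ _ _ _
    (iF1 _ S_k) (iF2 _ S_k) mu uk01 (threshold k.+1 isT)).
move=> k k_ge1; have [muk uk01] := u_bin k k_ge1.
have [S_k _] := argmin k k_ge1; have [S_k1 min_k1] := argmin k.+1 isT.
(* The intermediate state pairs the new [u k.+1] with the old [Theta k]. Passing to [Theta k.+1]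
   affects only the fidelity, where [Theta k] is a competitor in the minimization. *)
apply: (@le_trans _ _
  (energy tau lambda (F1 f (Theta k)) (F2 f (Theta k)) (u k.+1))).
  by rewrite /energy lerD2r; exact: min_k1.
exact: (@threshold_energy_le _ _ _ (plane_measure R) _ mOm finOm _ bK
  _ _ _ _ _ (iF1 _ S_k) (iF2 _ S_k) c_ge0 muk uk01 (threshold k k_ge1) KC Kpsd).
Qed.
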